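(* Let $b\ge 2$ be a fixed integer. There are constants $c,C>0$ (not depending on $\lambda$) such that for every real $\lambda>0$ the expected number of vertices $\chi(\lambda)$ of the random multigraph $G(\lambda)$ satisfies $$e^{c\lambda}<\chi(\lambda)<e^{e^{C\lambda}}.$$
   Context: A multigraph may have several parallel edges between two distinct vertices. $\mathrm{Po}(\mu)$ is the Poisson distribution with mean $\mu$. $(G(\lambda),o)$ is the unique (in distribution, up to root-preserving isomorphism) rooted connected random multigraph whose root has finite expected degree and whose distribution is invariant under the following operation: replace each vertex $v$ (including the root $o$) by $b$ vertices $v_0,\dots,v_{b-1}$, and for each unordered pair $i\ne j$ join $v_i$ to $v_j$ by $\mathrm{Po}(\lambda/b)$ parallel edges; replace each edge $uv$ by one of the $b^2$ edges $v_iu_j$ ($0\le i,j\le b-1$) chosen uniformly at random; all choices are independent; choose the new root uniformly among $o_0,\dots,o_{b-1}$; finally discard all components not containing the root. Equivalently, $G(\lambda)$ has the distribution of the component of the identity $\mathbf 0$ in the following random multigraph with vertex set $\Gamma=\bigoplus_{i\in\{1,2,\dots\}}\mathbb{Z}_b$ (finitely supported sequences over $\mathbb{Z}/b\mathbb{Z}$): independently for each unordered pair of distinct $x,y\in\Gamma$, the number of $x$–$y$ edges has distribution $\mathrm{Po}(\lambda b^{1-2h(x,y)})$, where $h(x,y)\ge1$ is the largest index of a coordinate in which $x$ and $y$ differ. *)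

(* Defs.v *)
From HB Require Import structures.
From mathcomp Require Import all_boot all_order all_algebra finmap.
From mathcomp Require Import all_classical all_reals all_analysis.

Set Implicit Arguments.
Unset Strict Implicit.
Unset Printing Implicit Defensive.

Import Order.TTheory GRing.Theory Num.Theory.
Import numFieldNormedType.Exports.

Local Open Scope classical_set_scope.
Local Open Scope ring_scope.

Definition upair (V : choiceType) := {e : {fset V} | #|` e | == 2%N}.

(* Loopless multigraphs on V: the number of parallel edges of each pair. *)
Definition multigraph (V : choiceType) := upair V -> nat.

Definition adj (V : choiceType) (m : multigraph V) : rel V :=
  fun x y => `[< exists e : upair V, val e = [fset x; y]%fset /\ (0 < m e)%N >].

Definition component (V : choiceType) (m : multigraph V) (o : V) : set V :=
  [set x | exists2 p : seq V, path (adj m) o p & x = last o p].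

Definition mutually_independent (d d' : measure_display)
    (Omega : measurableType d) (T : measurableType d') (R : realType)
    (P : probability Omega R) (I : choiceType) (X : I -> {RV P >-> T}) : Prop :=
  forall (J : {fset I}) (A : I -> set T), (forall i, measurable (A i)) ->
    P (\bigcap_(i in [set` J]) (X i @^-1` A i)) =
    (\prod_(i <- J) P (X i @^-1` A i))%E.

(* The direct sum of countably many copies of Z/b, for b >= 2: a finitely
   supported sequence is encoded as a polynomial, whose additive group is the
   pointwise one; the coefficient of 'X^i is the coordinate of index i + 1.
   The ring multiplication plays no role. *)
Definition Gam (b : nat) := {poly 'Z_b}.

(* The largest index (counted from 1) of a coordinate in which x and y differ;
   0 if x = y.  Coefficients beyond both sizes are 0 in x and in y. *)
Definition hdist (b : nat) (x y : Gam b) : nat :=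
  \max_(i < maxn (size x) (size y) | x`_i != y`_i) i.+1.

Definition hierarchical_multigraph (R : realType) (b : nat) (lambda : R)
    (d : measure_display) (Omega : measurableType d) (P : probability Omega R)
    (N : upair (Gam b) -> {RV P >-> nat}) : Prop :=
  mutually_independent N /\
  forall (x y : Gam b) (e : upair (Gam b)), val e = [fset x; y]%fset ->
    forall k : nat, P [set w | N e w = k] =
      (poisson_pmf (lambda * b%:R ^ (1 - 2 * (hdist x y)%:Z)) k)%:E.

(* The law of component (N ^~ w) 0 is that of G(lambda), rooted at 0, when
   hierarchical_multigraph lambda N holds. *)
Definition chi (R : realType) (b : nat) (d : measure_display)
    (Omega : measurableType d) (P : probability Omega R)
    (N : upair (Gam b) -> {RV P >-> nat}) : \bar R :=
  (\int[P]_w counting (component (fun e => N e w) (0%R : Gam b)))%E.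

(* Main.v *)
Require Import Defs.
From mathcomp Require Import all_boot all_order all_algebra.
From mathcomp Require Import reals sequences exp.
From mathcomp Require Import ring lra zify.
Set Implicit Arguments.
Unset Strict Implicit.
Unset Printing Implicit Defensive.
Import Order.TTheory GRing.Theory Num.Theory.
Local Open Scope ring_scope.

(* Only finite boxes matter: restricted to the sequences of length m, the graph
   is Bernoulli percolation on a finite group, and chi is the increasing limit
   of the mean cluster sizes in these boxes.

   Lower bound.  Two sibling blocks of level k fail to be joined by an edge with
   probability exp(-lambda/b), at every scale.  If no such failure occurs, the
   box of level m is connected; by a union bound this has probability at least
   1/2 as long as b^(2m) exp(-lambda/b) <= 1/2, so that m can be of order lambda.

   Upper bound.  Let H_n be the ball of radius n, T_n the mean size of the
   intersection of H_n with the cluster of 0, and X_n the mean size of the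
   cluster of 0 inside H_n.  Applying the positive quadratic form of the relation
   "u is connected to v" to the difference of the indicators of two sibling
   blocks, the density T_n/b^n is nonincreasing in n; as a block is isolated from
   the outside with probability at least exp(-lambda), independently of its
   inside, it drops at each step by at least exp(-lambda) X_n / (4 b^n).  Hence
   the densities X_n/b^n have sum at most 4 exp(lambda), and one of them with
   n <= 8 lambda exp(lambda) + 1 is at most 1/(2 lambda).  Since a vertex has at
   most lambda/b^n expected edges leaving its block, the Simon-Lieb inequality
   chi <= X_n + X_n (lambda/b^n) chi then gives chi <= 2 b^n. *)

(** * Product Bernoulli laws on the subsets of a finite set *)

Section BernoulliProduct.
Variables (R : realFieldType) (E : finType).
Implicit Types (p : E -> R) (S A : {set E}) (f g : {set E} -> R).

Definition bwt p S : R := \prod_e (if e \in S then p e else 1 - p e).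

Definition bexp p f : R := \sum_S bwt p S * f S.

Lemma sum_bwt p : \sum_S bwt p S = 1.
Proof.
rewrite /bwt -(bigA_distr _ _ p (fun e => 1 - p e)) big1 // => e _.
by rewrite /=; ring.
Qed.

Lemma eq_bexp p f g : f =1 g -> bexp p f = bexp p g.
Proof. by move=> fg; apply: eq_bigr => S _; rewrite fg. Qed.

Lemma bexp_cst p a : bexp p (fun=> a) = a.
Proof. by rewrite /bexp -mulr_suml sum_bwt mul1r. Qed.

Lemma bexpD p f g : bexp p (fun S => f S + g S) = bexp p f + bexp p g.
Proof. by rewrite -big_split; apply: eq_bigr => S _; rewrite mulrDr. Qed.

Lemma bexpZ p a f : bexp p (fun S => a * f S) = a * bexp p f.
Proof. by rewrite mulr_sumr; apply: eq_bigr => S _; rewrite mulrCA. Qed.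

Lemma bexpB p f g : bexp p (fun S => f S - g S) = bexp p f - bexp p g.
Proof.
rewrite -[- bexp p g]mulN1r -bexpZ -bexpD.
by apply: eq_bexp => S; rewrite mulN1r.
Qed.

Lemma bexp_sum p (I : finType) (Q : pred I) (F : I -> {set E} -> R) :
  bexp p (fun S => \sum_(i | Q i) F i S) = \sum_(i | Q i) bexp p (F i).
Proof.
by rewrite exchange_big; apply: eq_bigr => S _; rewrite -mulr_sumr.
Qed.

Lemma bexp_disjoint p A :
  bexp p (fun S => [disjoint S & A]%:R) = \prod_(e in A) (1 - p e).
Proof.
rewrite big_mkcond /=.
(* Write each factor as weight when open plus weight when closed, with open weight 0 on [A].
   Expanding the product, the terms of the sets meeting [A] vanish. *)
transitivity (\prod_e ((if e \in A then 0 else p e) + (1 - p e))); last first.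
  by apply: eq_bigr => e _; case: ifP => _; rewrite ?add0r // addrC subrK.
rewrite bigA_distr; apply: eq_bigr => S _; rewrite /bwt.
have [dSA|] := boolP [disjoint S & A].
  rewrite mulr1; apply: eq_bigr => e _; case: ifP => // eS.
  by rewrite (disjointFr dSA eS).
rewrite -setI_eq0 => /set0Pn[e /setIP[eS eA]].
by rewrite mulr0 (bigD1 e) //= eS eA mul0r.
Qed.

Lemma bexp_in p e : bexp p (fun S => (e \in S)%:R) = p e.
Proof.
transitivity (bexp p (fun S => 1 - [disjoint S & [set e]]%:R)).
  apply: eq_bexp => S; rewrite disjoint_sym disjoints1.
  by case: (e \in S); rewrite ?subr0 ?subrr.
by rewrite bexpB bexp_cst bexp_disjoint big_set1 subKr.
Qed.

(* Exchanging the parts outside [A] of two independent copies preserves their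
   joint law, and turns [f S * g S'] into [f S * g S]. *)
Lemma bexp_indep p A f g :
  (forall S, f S = f (S :&: A)) -> (forall S, g S = g (S :\: A)) ->
  bexp p (fun S => f S * g S) = bexp p f * bexp p g.
Proof.
move=> fA gA.
pose mix S S' := (S :&: A) :|: (S' :\: A).
pose sw (q : {set E} * {set E}) := (mix q.1 q.2, mix q.2 q.1).
have swK : involutive sw.
  move=> [S S']; rewrite /sw /mix /=.
  by congr (_, _); apply/setP=> e; rewrite !inE; case: (e \in A); rewrite ?andbF ?andbT ?orbF.
have -> : bexp p f * bexp p g =
    \sum_(q : {set E} * {set E}) bwt p q.1 * bwt p q.2 * (f q.1 * g q.2).
  rewrite /bexp big_distrl -(pair_bigA _ (fun S S' => bwt p S * bwt p S' * (f S * g S'))) /=.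
  by apply: eq_bigr => S _; rewrite mulr_sumr; apply: eq_bigr => S' _; rewrite mulrACA.
rewrite (reindex_inj (inv_inj swK)) /=.
transitivity (\sum_(q : {set E} * {set E}) bwt p q.1 * bwt p q.2 * (f q.1 * g q.1)).
  rewrite -(pair_bigA _ (fun S S' => bwt p S * bwt p S' * (f S * g S))) /=.
  apply: eq_bigr => S _; rewrite -mulr_suml -mulr_sumr sum_bwt mulr1 //.
apply: eq_bigr => -[S S'] _ /=; congr (_ * (_ * _)).
- rewrite /bwt -!big_split /=; apply: eq_bigr => e _; rewrite !inE.
  by case: (e \in A); rewrite ?andbF ?andbT ?orbF //= mulrC.
- rewrite fA [RHS]fA; congr f; apply/setP=> e; rewrite !inE.
  by case: (e \in A); rewrite ?andbF ?andbT ?orbF.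
- rewrite gA [RHS]gA; congr g; apply/setP=> e; rewrite !inE.
  by case: (e \in A); rewrite ?andbF ?andbT ?orbF.
Qed.

Section Monotone.
Variable p : E -> R.
Hypothesis p01 : forall e, 0 <= p e <= 1.

Lemma bwt_ge0 S : 0 <= bwt p S.
Proof.
apply: prodr_ge0 => e _; have /andP[p0 p1] := p01 e.
by case: ifP => // _; rewrite subr_ge0.
Qed.

Lemma le_bexp f g : (forall S, f S <= g S) -> bexp p f <= bexp p g.
Proof. by move=> fg; apply: ler_sum => S _; rewrite ler_wpM2l ?bwt_ge0. Qed.

Lemma bexp_ge0 f : (forall S, 0 <= f S) -> 0 <= bexp p f.
Proof. by move=> f0; apply: sumr_ge0 => S _; rewrite mulr_ge0 ?bwt_ge0. Qed.

End Monotone.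

End BernoulliProduct.

(** * Bond percolation on a finite vertex set *)

Section Percolation.
Variables (R : realFieldType) (V : finType).
Implicit Types (S : {set {set V}}) (W A B C K : {set V}) (p : {set V} -> R).

Definition edge S W : rel V := fun x y => [&& x \in W, y \in W & [set x; y] \in S].

Definition conn S W : rel V := connect (edge S W).

Definition pconn p W x y : R := bexp p (fun S => (conn S W x y)%:R).

Definition cross A B : {set {set V}} := [set [set q.1; q.2] | q in setX A B].

Lemma edge_sym S W : symmetric (edge S W).
Proof. by move=> x y; rewrite /edge setUC andbCA. Qed.

Lemma conn_sym S W : symmetric (conn S W).
Proof. exact: sym_connect_sym (edge_sym S W). Qed.

Lemma conn_trans S W : transitive (conn S W).
Proof. exact: connect_trans. Qed.

Lemma conn_mono S W W' x y : W \subset W' -> conn S W x y -> conn S W' x y.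
Proof.
move=> WW'; apply: connect_sub => u v /and3P[uW vW uv].
by apply: connect1; rewrite /edge !(subsetP WW').
Qed.

Lemma mem_cross A B x y : x \in A -> y \in B -> [set x; y] \in cross A B.
Proof. by move=> xA yB; apply/imsetP; exists (x, y) => //; rewrite inE /= xA. Qed.

Lemma set2_eq_disjoint A B x y x' y' : [disjoint A & B] ->
  x \in A -> y \in B -> x' \in A -> y' \in B ->
  [set x; y] = [set x'; y'] -> x = x' /\ y = y'.
Proof.
move=> dAB xA yB x'A y'B /setP eqs.
have nAB u v : u \in A -> v \in B -> (u == v) = false.
  by move=> uA vB; apply/eqP => uv; move: (disjointFr dAB uA); rewrite uv vB.
move: (eqs x) (eqs y); rewrite !inE !eqxx /= orbT.
rewrite (nAB x y') // orbF [y == x']eq_sym (nAB x' y) //=.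
by move=> /esym/eqP -> /esym/eqP ->.
Qed.

Lemma bexp_disjoint_cross p A B : [disjoint A & B] ->
  bexp p (fun S => [disjoint S & cross A B]%:R) =
  \prod_(u in A) \prod_(v in B) (1 - p [set u; v]).
Proof.
move=> dAB; rewrite bexp_disjoint big_imset /=.
  rewrite pair_big_dep /=; apply: eq_bigl => -[u v]; by rewrite inE.
move=> [x y] [x' y'] /setXP[/= xA yB] /setXP[/= x'A y'B].
by move/(set2_eq_disjoint dAB xA yB x'A y'B) => [-> ->].
Qed.

(** An [e]-path started in [K] never leaves it, and each of its steps is also an [e']-step. With
    [e' = e] this expresses that [K] traps paths. *)
Lemma connect_closed_transfer (e e' : rel V) (K : {set V}) x y :
  (forall z w, z \in K -> e z w -> e' z w /\ w \in K) ->
  x \in K -> connect e x y -> connect e' x y /\ y \in K.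
Proof.
move=> ee' xK /connectP[q]; elim: q x xK => [|w q IH] x xK /=.
  by move=> _ ->.
case/andP => xw wq yE; have [xw' wK] := ee' _ _ xK xw.
have [wy yK] := IH _ wK wq yE.
by split => //; apply: connect_trans wy; apply: connect1.
Qed.

Lemma conn_in S W x y : conn S W x y -> x \in W -> y \in W.
Proof.
move=> xy xW; have /(_ _ xW xy) [] // :=
  @connect_closed_transfer (edge S W) (edge S W) W x y.
by move=> z w _ zw; split => //; case/and3P: zw.
Qed.

Lemma conn_restrict S W (F : {set {set V}}) x y :
  (forall u v, u \in W -> v \in W -> [set u; v] \in F) ->
  conn S W x y = conn (S :&: F) W x y.
Proof.
move=> WF; apply: eq_connect => u v; rewrite /edge inE.
case uW: (u \in W) => //=; case vW: (v \in W) => //=.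
by rewrite WF // andbT.
Qed.

Definition open_cluster S A x : {set V} := [set y | conn S A x y].

(** Exploring the cluster inside [A] only queries pairs with an endpoint already reached. This is
    what makes the value of the cluster independent of the edges away from it. *)
Lemma cluster_local S S' A K x :
  (forall u v, u \in K -> v \in A -> ([set u; v] \in S) = ([set u; v] \in S')) ->
  open_cluster S A x = K -> open_cluster S' A x = K.
Proof.
move=> SS' clK.
have inK y : (y \in K) = conn S A x y by rewrite -clK inE.
have xK : x \in K by rewrite inK /conn connect0.
apply/setP => y; rewrite inE inK; apply/idP/idP => xy.
- have /(_ _ xK xy) [] // :=
    @connect_closed_transfer (edge S' A) (edge S A) K x y.
  move=> z w zK zw; have zw' : edge S A z w.
    by case/and3P: zw => zA wA zwS; rewrite /edge zA wA SS'.
  by split=> //; move: zK; rewrite !inK => zK; apply: conn_trans zK (connect1 zw').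
- have /(_ _ xK xy) [] // :=
    @connect_closed_transfer (edge S A) (edge S' A) K x y.
  move=> z w zK zw; have wK : w \in K.
    by move: zK; rewrite !inK => zK; apply: conn_trans zK (connect1 zw).
  by split => //; case/and3P: zw => zA wA zwS; rewrite /edge zA wA -SS'.
Qed.

(** Cut the path at its last visit to [C]. The first alternative, a path that never visits [C], lets
    the induction on the path go through. *)
Lemma conn_last_exit S C z x : x \notin C -> conn S setT z x ->
  (z \notin C) && conn S (~: C) z x \/
  exists u v, [/\ u \in C, v \notin C, [set u; v] \in S & conn S (~: C) v x].
Proof.
move=> xC /connectP[q]; elim: q z => [|w q IH] z /=.
  by move=> _ <-; left; rewrite xC /conn connect0.
case/andP => /and3P[_ _ zw] wq xE; have [/andP[wC wx]|] := IH _ wq xE; last by right.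
have [zC|zC] := boolP (z \in C); first by right; exists z, w.
left; rewrite /=; apply: conn_trans wx; apply: connect1.
by rewrite /edge !inE zC wC.
Qed.

(** * The Simon-Lieb inequality and the comparison of two blocks *)

Section SimonLieb.
Variable p : {set V} -> R.
Hypothesis p01 : forall e, 0 <= p e <= 1.

Lemma pconn_ge0 W x y : 0 <= pconn p W x y.
Proof. by apply: bexp_ge0 => // S. Qed.

Lemma pconn_mono W W' x y : W \subset W' -> pconn p W x y <= pconn p W' x y.
Proof.
move=> WW'; apply: le_bexp => // S.
case xy: (conn S W x y); last by case: conn.
by rewrite (conn_mono WW' xy).
Qed.

Lemma pconn_le1 W x y : pconn p W x y <= 1.
Proof.
rewrite -[leRHS](bexp_cst p); apply: le_bexp => // S.
by case: conn.
Qed.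

Lemma pconnxx W x : pconn p W x x = 1.
Proof.
rewrite -[RHS](bexp_cst p); apply: eq_bexp => S.
by rewrite /conn connect0.
Qed.

(* The three events concern disjoint sets of edges: those inside [A] that meet
   [K], the edge [uv], and those inside the complement of [K]. *)
Lemma bexp_cluster_exit A K u0 u v x : K \subset A -> u \in K -> v \notin A ->
  bexp p (fun S => (open_cluster S A u0 == K)%:R *
     (([set u; v] \in S)%:R * (conn S (~: K) v x)%:R)) =
  bexp p (fun S => (open_cluster S A u0 == K)%:R) * (p [set u; v] * pconn p (~: K) v x).
Proof.
move=> KA uK vA.
pose F := [set e : {set V} | (e \subset A) && (e :&: K != set0)].
pose G := [set [set u; v]].
rewrite (@bexp_indep _ _ p F); last first.
- move=> S; congr (_%:R * _%:R).
    by rewrite in_setD [_ \in F]inE subUset !sub1set (negbTE vA) andbF.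
  rewrite (@conn_restrict _ _ (~: F)) ?setDE //.
  move=> y z; rewrite !inE => yK zK; rewrite negb_and negbK; apply/orP; right.
  by apply/eqP/setP=> t; rewrite !inE; apply/negP => /andP[/orP[]/eqP ->]; apply/negP.
- move=> S; congr ((nat_of_bool _)%:R); apply/eqP/eqP; apply: cluster_local => y z yK zA.
    rewrite [in RHS]inE; case: (_ \in S) => //=; apply/esym; rewrite inE subUset !sub1set zA (subsetP KA) //=.
    by apply/set0Pn; exists y; rewrite !inE eqxx.
  rewrite [in LHS]inE; case: (_ \in S) => //=; rewrite inE subUset !sub1set zA (subsetP KA) //=.
  by apply/set0Pn; exists y; rewrite !inE eqxx.
congr (_ * _); rewrite (@bexp_indep _ _ p G) ?bexp_in //.
  by move=> S; rewrite !inE eqxx andbT.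
move=> S; rewrite (@conn_restrict _ _ (~: G)) ?setDE //.
move=> y z; rewrite !inE => yK zK; apply/eqP => eq_yz.
have : u \in [set y; z] by rewrite eq_yz !inE eqxx.
by rewrite !inE => /orP[]/eqP uE; [rewrite -uE uK in yK | rewrite -uE uK in zK].
Qed.

(** Decompose over the value [K] of the cluster of [u0] inside [A]. If it misses [x], a path to [x]
    leaves it for the last time through an edge [uv]; then [v] is outside [A], since otherwise it
    would belong to the cluster. For fixed [K] the three events are independent. *)
Lemma simon_lieb A u0 x : u0 \in A ->
  pconn p setT u0 x <= pconn p A u0 x +
    \sum_(u in A) \sum_(v in ~: A)
      pconn p A u0 u * (p [set u; v] * pconn p setT v x).
Proof.
move=> u0A.
pose T (K : {set V}) u v S : R := (open_cluster S A u0 == K)%:R *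
     (([set u; v] \in S)%:R * (conn S (~: K) v x)%:R).
have T0 K u v S : 0 <= T K u v S by rewrite !mulr_ge0.
have step1 S : (conn S setT u0 x)%:R <= (conn S A u0 x)%:R +
    \sum_(u in A) \sum_(v in ~: A) \sum_(K : {set V} | (K \subset A) && (u \in K)) T K u v S.
  have s0 : 0 <= \sum_(u in A) \sum_(v in ~: A)
      \sum_(K : {set V} | (K \subset A) && (u \in K)) T K u v S.
    by do 3! (apply: sumr_ge0 => ? _).
  case xy: (conn S setT u0 x); last by rewrite addr_ge0.
  have [ax|ax] := boolP (conn S A u0 x); first by rewrite lerDl.
  pose C := open_cluster S A u0.
  have xC : x \notin C by rewrite inE.
  have u0C : u0 \in C by rewrite inE /conn connect0.
  have CA : C \subset A by apply/subsetP => y; rewrite inE => /conn_in; apply.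
  rewrite add0r.
  have [|[u [v [uC vC uv vx]]]] := conn_last_exit xC xy; first by rewrite u0C.
  have uA := subsetP CA _ uC.
  have vA : v \notin A.
    apply: contra vC => vA; move: uC; rewrite !inE => uC; apply: connect_trans uC (connect1 _).
    by rewrite /edge uA vA.
  rewrite (bigD1 u) //= (bigD1 v) ?inE //= (bigD1 C) ?CA //=.
  rewrite -!addrA {1}/T eqxx uv vx !mulr1 lerDl.
  by rewrite !addr_ge0 //; do ?[apply: sumr_ge0 => ? _].
apply: le_trans (le_bexp p01 step1) _.
rewrite bexpD lerD2l bexp_sum ler_sum // => u uA; rewrite bexp_sum ler_sum // => v.
rewrite inE bexp_sum => vA.
(* The cluster takes exactly one value, so the probabilities of the values containing [u] add up to
   that of connecting [u0] to [u]. *)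
have -> : pconn p A u0 u =
    \sum_(K : {set V} | (K \subset A) && (u \in K)) bexp p (fun S => (open_cluster S A u0 == K)%:R).
  rewrite -bexp_sum; apply: eq_bexp => S.
  have [uc|uc] := boolP (conn S A u0 u).
    rewrite (bigD1 (open_cluster S A u0)) /=; last first.
      by rewrite inE uc andbT; apply/subsetP => y; rewrite inE => /conn_in; apply.
    rewrite eqxx big1 ?addr0 // => K /andP[_].
    by rewrite eq_sym => /negbTE ->.
  rewrite big1 // => K /andP[_ uK]; case: eqP => // KE.
  by move: uK; rewrite -KE inE (negbTE uc).
rewrite mulr_suml ler_sum // => K /andP[KA uK]; rewrite bexp_cluster_exit //.
rewrite ler_wpM2l ?bexp_ge0 // ler_wpM2l ?pconn_mono ?subsetT //.
by have /andP[] := p01 [set u; v].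
Qed.

(* The connection relation is an equivalence, so its quadratic form is
   nonnegative; it is evaluated at the difference of two indicators. *)
Lemma conn_two_blocks S A B :
  0 <= (\sum_(u in A) \sum_(v in A) (conn S setT u v)%:R : R) +
    \sum_(u in B) \sum_(v in B) (conn S setT u v)%:R -
    (\sum_(u in A) \sum_(v in B) (conn S setT u v)%:R) *+ 2.
Proof.
pose e := edge S setT.
have rootE u v : (conn S setT u v)%:R =
    \sum_w (fingraph.root e u == w)%:R * (fingraph.root e v == w)%:R :> R.
  rewrite (bigD1 (fingraph.root e u)) //= eqxx mul1r big1 ?addr0; last first.
    by move=> w wr; rewrite eq_sym (negbTE wr) mul0r.
  by rewrite [_ == _]eq_sym (root_connect (conn_sym S setT)).
have sumE (X Y : {set V}) :
    \sum_(u in X) \sum_(v in Y) (conn S setT u v)%:R =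
    \sum_w (\sum_(u in X) (fingraph.root e u == w)%:R) * (\sum_(v in Y) (fingraph.root e v == w)%:R) :> R.
  under eq_bigr do under eq_bigr do rewrite rootE.
  under eq_bigr do rewrite exchange_big /=.
  rewrite exchange_big /=; apply: eq_bigr => w _; rewrite mulr_suml.
  by apply: eq_bigr => u _; rewrite mulr_sumr.
rewrite !sumE -sumrMnl -big_split -sumrB /=; apply: sumr_ge0 => w _.
set a := \sum_(u in A) _; set c := \sum_(u in B) _.
have -> : a * a + c * c - a * c *+ 2 = (a - c) ^+ 2 by ring.
exact: sqr_ge0.
Qed.

Lemma conn_isolated S A u v : [disjoint S & cross A (~: A)] ->
  u \in A -> conn S setT u v -> v \in A.
Proof.
move=> iso uA uv; have /(_ _ uA uv) [] // :=
  @connect_closed_transfer (edge S setT) (edge S setT) A u v.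
move=> z w zA zw; split=> //; apply/negPn/negP => wA.
case/and3P: zw => _ _ zwS; move: (disjointFr iso zwS).
by rewrite mem_cross // inE.
Qed.

(** If no edge leaves [A], the mixed terms of the form vanish and the connections inside [A] remain;
    otherwise the form is still nonnegative. Isolation depends on the edges leaving [A] and the
    connections inside on the others, so the expectation factors. *)
Lemma pconn_two_blocks A B : [disjoint A & B] ->
  bexp p (fun S => [disjoint S & cross A (~: A)]%:R) *
    (\sum_(u in A) \sum_(v in A) pconn p A u v) <=
  \sum_(u in A) \sum_(v in A) pconn p setT u v +
  \sum_(u in B) \sum_(v in B) pconn p setT u v -
    (\sum_(u in A) \sum_(v in B) pconn p setT u v) *+ 2.
Proof.
move=> dAB.
have bE (X Y W : {set V}) : \sum_(u in X) \sum_(v in Y) pconn p W u v =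
    bexp p (fun S => \sum_(u in X) \sum_(v in Y) (conn S W u v)%:R).
  by rewrite bexp_sum; apply: eq_bigr => u _; rewrite bexp_sum.
rewrite !bE -(mulr_natl (bexp _ _) 2) -(bexpZ p 2%:R) -bexpD -bexpB.
rewrite -(@bexp_indep _ _ p (cross A (~: A))); last first.
- move=> S; apply: eq_bigr => u _; apply: eq_bigr => v _; congr ((nat_of_bool _)%:R).
  rewrite setDE; apply: conn_restrict => {}u {}v uA vA; rewrite inE.
  apply/negP => /imsetP[[y z]] /setXP[/= yA zA] uvE.
  have : z \in [set u; v] by rewrite uvE !inE eqxx orbT.
  by move: zA; rewrite !inE => zA /orP[]/eqP zE; move: zA; rewrite zE ?uA ?vA.
- by move=> S; rewrite -!setI_eq0 -setIA setIid.
apply: le_bexp => // S; rewrite (mulr_natl _ 2).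
have [iso|_] := boolP [disjoint S & cross A (~: A)]; last by rewrite mul0r conn_two_blocks.
rewrite mul1r.
have -> : \sum_(u in A) \sum_(v in B) (conn S setT u v)%:R = 0 :> R.
  rewrite big1 // => u uA; rewrite big1 // => v vB.
  case uv : (conn S setT u v) => //.
  by move: (conn_isolated iso uA uv) vB => vA; rewrite (disjointFr dAB vA).
rewrite mul0rn subr0 -[leLHS]addr0 lerD //; last by do 2 apply: sumr_ge0 => ? _.
apply: ler_sum => u uA; apply: ler_sum => v vA.
case uv: (conn S A u v); last by case: conn.
by rewrite (conn_mono (subsetT A) uv).
Qed.

End SimonLieb.

Lemma connect_inj_map (e e' : rel V) (f : V -> V) x y : injective f ->
  (forall u v, e' (f u) (f v) = e u v) -> connect e' (f x) (f y) = connect e x y.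
Proof.
move=> finj ee'; have pe q z : path e' (f z) (map f q) = path e z q.
  by rewrite path_map; apply: eq_path.
apply/connectP/connectP => -[q].
  move=> xq yE; exists (map (invF finj) q).
    by rewrite -pe -map_comp (@eq_map _ _ _ id) ?map_id // => z /=; rewrite f_invF.
  by apply: (finj); rewrite -last_map -map_comp (@eq_map _ _ _ id) ?map_id // => z /=; rewrite f_invF.
by move=> xq ->; exists (map f q); rewrite ?pe ?last_map.
Qed.

Lemma pconn_inj p (f : V -> V) W x y : injective f ->
  (forall e : {set V}, p (f @: e) = p e) ->
  pconn p (f @: W) (f x) (f y) = pconn p W x y.
Proof.
move=> finj pf; pose F (e : {set V}) := f @: e.
have Finj : injective F by apply: imset_inj.
have FFinj : injective (fun S : {set {set V}} => F @: S) by apply: imset_inj.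
rewrite /pconn /bexp (reindex_inj FFinj) /=; apply: eq_bigr => S _; congr (_ * (nat_of_bool _)%:R).
  rewrite /bwt (reindex_inj Finj) /=; apply: eq_bigr => e _.
  by rewrite mem_imset // pf.
rewrite /conn; apply: connect_inj_map => // u v; rewrite /edge !mem_imset //.
have -> : [set f u; f v] = F [set u; v] by rewrite /F imsetU !imset_set1.
by rewrite mem_imset.
Qed.

End Percolation.

(** * Hierarchical percolation on a finite group *)

Section HierarchicalPercolation.
Variables (R : realType) (V : finZmodType) (lev : V -> nat) (b m : nat) (lambda : R).
Hypothesis b_gt1 : (1 < b)%N.
Hypothesis lambda_gt0 : 0 < lambda.
Hypothesis lev_eq0 : forall v, (lev v == 0%N) = (v == 0).
Hypothesis levB : forall u v, (lev (u - v)%R <= maxn (lev u) (lev v))%N.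
Hypothesis lev_le : forall v, (lev v <= m)%N.
Hypothesis card_lev_le : forall n, (n <= m)%N -> #|[set v | (lev v <= n)%N]%SET| = (b ^ n)%N.

(** The Poisson mean of the number of edges between two vertices with difference [v]; [pedge] is the
    resulting probability of at least one edge. *)
Definition rate (v : V) : R := lambda * b%:R ^ (1 - 2 * (lev v)%:Z).

(* For a pair [e = {u, v}] the double sum counts [rate (u - v)] twice. *)
Definition pedge (e : {set V}) : R :=
  if #|e| == 2%N
  then 1 - expR (- (\sum_(u in e) \sum_(v in e | v != u) rate (u - v)) / 2)
  else 0.

(** By the ultrametric inequality [levB] the balls are subgroups; their cosets are the blocks of the
    hierarchy. *)
Definition ball n : {set V} := [set v | (lev v <= n)%N]%SET.

Let b_gt0 : (0 : R) < b%:R. Proof. by rewrite ltr0n ltnW. Qed.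

Let bX_gt0 n : (0 : R) < b%:R ^+ n. Proof. by rewrite exprn_gt0. Qed.

Lemma lev0 : lev 0 = 0%N. Proof. by apply/eqP; rewrite lev_eq0. Qed.

Lemma levN v : lev (- v) = lev v.
Proof.
have H u : (lev (- u)%R <= lev u)%N by rewrite -sub0r (leq_trans (levB _ _)) // lev0 max0n.
by apply/eqP; rewrite eqn_leq H -{1}[v]opprK H.
Qed.

Lemma levBC u v : lev (u - v) = lev (v - u). Proof. by rewrite -levN opprB. Qed.

Lemma ball0 n : 0 \in ball n. Proof. by rewrite inE lev0. Qed.

Lemma ballB n u v : u \in ball n -> v \in ball n -> u - v \in ball n.
Proof. by rewrite !inE => un vn; rewrite (leq_trans (levB _ _)) // geq_max un. Qed.

Lemma ballN n u : u \in ball n -> - u \in ball n.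
Proof. by rewrite !inE levN. Qed.

Lemma ballD n u v : u \in ball n -> v \in ball n -> u + v \in ball n.
Proof. by move=> un vn; rewrite -[v]opprK ballB ?ballN. Qed.

Lemma ballDr n u v : u \in ball n -> (u + v \in ball n) = (v \in ball n).
Proof.
move=> un; apply/idP/idP => [uv|]; last exact: ballD.
by rewrite -[v](addKr u) ballD ?ballN.
Qed.

Lemma ballS n : ball n \subset ball n.+1.
Proof. by apply/subsetP => v; rewrite !inE => /leqW. Qed.

Lemma rateN v : rate (- v) = rate v. Proof. by rewrite /rate levN. Qed.

Lemma rateE v k : lev v = k -> rate v = lambda * (b%:R * (b%:R ^+ k)^-1 ^+ 2).
Proof.
rewrite /rate => ->; rewrite expfzDr ?gt_eqF // expr1z; congr (_ * (_ * _)).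
by rewrite -[- _]/(- Posz (2 * k)) -exprnN exprVn -exprM mulnC.
Qed.

Lemma rate_gt0 v : 0 < rate v.
Proof. by rewrite mulr_gt0 // exprz_gt0. Qed.

Lemma pedge2 u v : u != v -> pedge [set u; v]%SET = 1 - expR (- rate (u - v)).
Proof.
move=> uv; rewrite /pedge cards2 uv /=; congr (1 - expR _).
have -> : \sum_(x in [set u; v]%SET) \sum_(y in [set u; v]%SET | y != x) rate (x - y) =
    rate (u - v) + rate (v - u).
  rewrite big_setU1 ?inE //= big_set1; congr (_ + _).
    rewrite (big_pred1 v) // => y /=; rewrite !inE.
    by case: (eqVneq y u) => [->|]; rewrite ?(negbTE uv) ?andbF ?andbT.
  rewrite (big_pred1 u) // => y /=; rewrite !inE.
  by case: (eqVneq y v) => [->|]; rewrite ?andbT ?orbF // eq_sym (negbTE uv) andbF.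
rewrite -[v - u]opprB rateN; lra.
Qed.

Lemma pedge01 e : 0 <= pedge e <= 1.
Proof.
rewrite /pedge; case: ifP => _; last by rewrite lexx ler01.
rewrite subr_ge0 lerBlDr lerDl expR_ge0 andbT -[leRHS]expR0 ler_expR.
rewrite mulNr oppr_le0 divr_ge0 //; do 2 apply: sumr_ge0 => ? _.
exact/ltW/rate_gt0.
Qed.

Lemma pedge_le_rate u v : u != v -> pedge [set u; v]%SET <= rate (u - v).
Proof. by move=> uv; rewrite pedge2 // lerBlDr -lerBlDl; exact: expR_ge1Dx. Qed.

Lemma pedge_shift g (e : {set V}) : pedge [set g + x | x in e]%SET = pedge e.
Proof.
have ginj : injective (fun x : V => g + x) by apply: addrI.
rewrite /pedge card_imset //; case: ifP => // _; congr (1 - expR (- _ / 2)).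
rewrite big_imset; last by move=> ? ? _ _; apply: ginj.
apply: eq_bigr => u _; rewrite big_imset_cond; last by move=> ? ? _ _; apply: ginj.
apply: eq_big => [v|v _]; first by rewrite (inj_eq ginj).
by rewrite opprD addrACA subrr add0r.
Qed.

Lemma pconn_shift g (W : {set V}) x y :
  pconn pedge [set g + z | z in W]%SET (g + x) (g + y) = pconn pedge W x y.
Proof. by apply: pconn_inj; [exact: addrI | exact: pedge_shift]. Qed.

Lemma shift_ball n g : g \in ball n -> [set g + z | z in ball n]%SET = ball n.
Proof.
move=> gn; apply/setP => x; apply/imsetP/idP => [[z zn ->]|xn]; first exact: ballD.
by exists (- g + x); rewrite ?addNKr // ballD // ballN.
Qed.

Lemma pconn_ball n g x : g \in ball n ->
  pconn pedge (ball n) g (g + x) = pconn pedge (ball n) 0 x.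
Proof. by move=> gn; rewrite -(pconn_shift g _ 0) addr0 shift_ball. Qed.

Lemma pconnT g x : pconn pedge setT%SET g (g + x) = pconn pedge setT%SET 0 x.
Proof.
rewrite -(pconn_shift g _ 0) addr0; congr (pconn _ _ _ _).
by apply/setP => z; rewrite !inE; apply/esym/imsetP; exists (- g + z); rewrite ?addNKr.
Qed.

Lemma sum_ball n g (F : V -> R) : g \in ball n ->
  \sum_(v in ball n) F v = \sum_(v in ball n) F (g + v).
Proof.
move=> gn; rewrite (reindex_inj (@addrI _ g)) /=.
by apply: eq_bigl => v; rewrite ballDr.
Qed.

Lemma card_sphere n : (n < m)%N -> #|[set v | lev v == n.+1]%SET| = (b ^ n.+1 - b ^ n)%N.
Proof.
move=> nm; rewrite -!card_lev_le ?(ltnW nm) //.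
rewrite -[X in (_ = X - _)%N](cardsID (ball n)).
have -> : (ball n.+1 :&: ball n = ball n)%SET by apply/setIidPr/ballS.
rewrite addKn; apply: eq_card => v; rewrite !inE -ltnNge.
by rewrite eqn_leq andbC.
Qed.

(** The sphere of level [k+1] contributes [lambda / b^k - lambda / b^(k+1)], so the sum telescopes.
    The induction descends from level [m], beyond which there is no vertex. *)
Lemma sum_rate_outside n : (n <= m)%N ->
  \sum_(v | v \notin ball n) rate v <= lambda / b%:R ^+ n.
Proof.
move=> nm; rewrite -(subKn nm).
elim: (m - n)%N (leq_subr n m) => [_|d IH dm].
  rewrite subn0 big_pred0 ?divr_ge0 ?ltW // => v.
  by rewrite inE lev_le.
pose k := (m - d.+1)%N.
have kE : (m - d = k.+1)%N by rewrite /k; lia.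
have km : (k < m)%N by rewrite /k; lia.
rewrite -/k (bigID (fun v => lev v == k.+1)) /=.
have -> : \sum_(v | (v \notin ball k) && (lev v == k.+1)) rate v =
    lambda / b%:R ^+ k - lambda / b%:R ^+ k.+1.
  rewrite (eq_bigl (mem [set v | lev v == k.+1]%SET)); last first.
    by move=> v; rewrite !inE -ltnNge; case: eqP => [->|]; rewrite ?ltnSn ?andbF.
  rewrite (eq_bigr (fun=> lambda * (b%:R * (b%:R ^+ k.+1)^-1 ^+ 2))); last first.
    by move=> v; rewrite /= inE => /eqP; exact: rateE.
  rewrite sumr_const card_sphere // -[_ *+ _]mulr_natl natrB ?leq_exp2l // !natrX exprS.
  by field; rewrite !gt_eqF.
rewrite (eq_bigl (fun v => v \notin ball k.+1)); last first.
  by move=> v; rewrite !inE -!ltnNge [RHS]ltn_neqAle andbC eq_sym.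
by rewrite -lerBrDl opprB addrC subrK -kE IH // ltnW.
Qed.

Lemma cross_expE (A B : {set V}) : [disjoint A & B] ->
  bexp pedge (fun S => [disjoint S & cross A B]%:R) =
  expR (- \sum_(u in A) \sum_(v in B) rate (u - v)).
Proof.
move=> dAB; rewrite bexp_disjoint_cross // -sumrN expR_sum; apply: eq_bigr => u uA.
rewrite -sumrN expR_sum; apply: eq_bigr => v vB; rewrite pedge2 ?subKr //.
by apply/eqP => uv; move: (disjointFr dAB uA); rewrite uv vB.
Qed.

Lemma disjoint_setC (A : {set V}) : [disjoint A & ~: A]%SET.
Proof. by rewrite -setI_eq0 setICr. Qed.

Lemma sum_rate_from n u : (n <= m)%N -> u \in ball n ->
  \sum_(v in ~: ball n) rate (u - v) <= lambda / b%:R ^+ n.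
Proof.
move=> nm un; apply: le_trans (sum_rate_outside nm).
rewrite (reindex_inj (@addrI _ u)) /= le_eqVlt; apply/orP; left; apply/eqP.
apply: eq_big => [v|v _]; first by rewrite inE ballDr.
by rewrite opprD addNKr rateN.
Qed.

(** Each of the [b^n] vertices sends out a total rate of at most [lambda / b^n], so the exponent is
    bounded by [lambda] at every scale. *)
Lemma isolated_ball n : (n <= m)%N ->
  expR (- lambda) <= bexp pedge (fun S => [disjoint S & cross (ball n) (~: ball n)]%:R).
Proof.
move=> nm; rewrite cross_expE ?disjoint_setC // ler_expR lerN2.
apply: (@le_trans _ _ (\sum_(u in ball n) lambda / b%:R ^+ n)).
  by apply: ler_sum => u un; apply: sum_rate_from.
rewrite sumr_const card_lev_le // -[_ *+ _]mulr_natr natrX divfK //.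
by rewrite gt_eqF.
Qed.

(** * The mean sizes T_n ([tball]) and X_n ([xball]), and the upper bound on the susceptibility of a
    box *)

Definition tball n : R := \sum_(v in ball n) pconn pedge setT%SET 0 v.
Definition xball n : R := \sum_(v in ball n) pconn pedge (ball n) 0 v.
Definition susceptibility : R := \sum_v pconn pedge setT%SET 0 v.

Lemma xball_ge0 n : 0 <= xball n.
Proof. by apply: sumr_ge0 => v _; apply/pconn_ge0/pedge01. Qed.

Lemma xball_le n : (n <= m)%N -> xball n <= b%:R ^+ n.
Proof.
move=> nm; apply: (@le_trans _ _ (\sum_(v in ball n) 1)).
  by apply: ler_sum => v _; apply/pconn_le1/pedge01.
by rewrite sumr_const card_lev_le // natrX.
Qed.

(** Apply [pconn_two_blocks] to the ball and its coset by [g]. By translation invariance every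
    double sum is [b^n] times a single sum, and this factor cancels. *)
Lemma sphere_avg n g : (n <= m)%N -> g \notin ball n ->
  expR (- lambda) * xball n <=
  tball n *+ 2 - (\sum_(v in ball n) pconn pedge setT%SET 0 (g + v)) *+ 2.
Proof.
move=> nm gn; pose A := ball n; pose B := [set g + z | z in A]%SET.
have dAB : [disjoint A & B].
  rewrite -setI_eq0; apply/eqP/setP => x; rewrite in_setI in_set0.
  apply/negbTE/negP => /andP[xA /imsetP[z zA xE]]; case/negP: gn.
  have -> : g = x - z by rewrite xE addrK.
  exact: ballB.
have := pconn_two_blocks pedge01 dAB.
have sumB (F : V -> R) : \sum_(v in B) F v = \sum_(v in A) F (g + v).
  by rewrite big_imset // => ? ? _ _; apply: addrI.
have -> : \sum_(u in A) \sum_(v in A) pconn pedge A u v = (b ^ n)%:R * xball n.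
  rewrite -(card_lev_le nm) mulr_natl -sumr_const; apply: eq_bigr => u uA.
  by rewrite (@sum_ball n u) //; apply: eq_bigr => v _; rewrite pconn_ball.
have -> : \sum_(u in A) \sum_(v in A) pconn pedge setT%SET u v = (b ^ n)%:R * tball n.
  rewrite -(card_lev_le nm) mulr_natl -sumr_const; apply: eq_bigr => u uA.
  by rewrite (@sum_ball n u) //; apply: eq_bigr => v _; rewrite pconnT.
have -> : \sum_(u in B) \sum_(v in B) pconn pedge setT%SET u v = (b ^ n)%:R * tball n.
  rewrite -(card_lev_le nm) mulr_natl -sumr_const sumB; apply: eq_bigr => u uA.
  rewrite sumB (@sum_ball n u) //; apply: eq_bigr => v _; by rewrite addrA pconnT.
have -> : \sum_(u in A) \sum_(v in B) pconn pedge setT%SET u v =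
    (b ^ n)%:R * \sum_(v in A) pconn pedge setT%SET 0 (g + v).
  rewrite -(card_lev_le nm) mulr_natl -sumr_const; apply: eq_bigr => u uA.
  rewrite sumB (@sum_ball n u) //; apply: eq_bigr => v _; by rewrite addrCA pconnT.
have bn0 : (0 : R) < (b ^ n)%:R by rewrite natrX.
move: (isolated_ball nm); rewrite -/A.
set q := bexp _ _; set t := \sum_(v in A) _ => q_ge ineq.
rewrite -(ler_pM2l bn0) mulrCA; apply: (@le_trans _ _ (q * ((b ^ n)%:R * xball n))).
  by rewrite ler_wpM2r // mulr_ge0 ?xball_ge0 // ltW.
apply: (le_trans ineq); rewrite le_eqVlt; apply/orP; left; apply/eqP; ring.
Qed.

(** Sum [sphere_avg] over the sphere of level [n+1]. The result carries a factor [b - 1] on the left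
    and 2 on the right; since [b >= 2], [b <= 2 (b - 1)], whence the constant 4. *)
Lemma density_drop n : (n < m)%N ->
  expR (- lambda) * (xball n / b%:R ^+ n) <=
  4 * (tball n / b%:R ^+ n - tball n.+1 / b%:R ^+ n.+1).
Proof.
move=> nm; pose D := [set v | lev v == n.+1]%SET.
have DE v : (v \in D) = (v \in ball n.+1) && (v \notin ball n).
  by rewrite !inE -ltnNge eqn_leq.
(* The sphere is a difference of two subgroups, hence stable under translation by [v]. *)
have sumD v : v \in ball n ->
    \sum_(g in D) pconn pedge setT%SET 0 (g + v) = tball n.+1 - tball n.
  move=> vn; rewrite /tball (bigID (mem (ball n)) (mem (ball n.+1))) /=.
  rewrite [X in _ = X + _ - _](eq_bigl (mem (ball n))); last first.
    move=> w; rewrite /= andb_idl // => wn; exact: (subsetP (ballS n)).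
  rewrite [X in _ = X - _]addrC addrK (reindex_inj (@addIr _ (- v))) /=.
  apply: eq_big => [w|w _]; last by rewrite subrK.
  rewrite DE addrC !ballDr ?ballN // ?(subsetP (ballS n)) ?ballN //.
have : \sum_(g in D) expR (- lambda) * xball n <=
    \sum_(g in D) (tball n *+ 2 - (\sum_(v in ball n) pconn pedge setT%SET 0 (g + v)) *+ 2).
  apply: ler_sum => g; rewrite DE => /andP[_ gn]; exact: sphere_avg (ltnW nm) gn.
have sumDb : \sum_(g in D) \sum_(v in ball n) pconn pedge setT%SET 0 (g + v) =
    \sum_(v in ball n) (tball n.+1 - tball n).
  by rewrite exchange_big /=; apply: eq_bigr => v; exact: sumD.
rewrite big_split /= sumrN !sumrMnl sumDb.
rewrite !sumr_const card_sphere // card_lev_le ?(ltnW nm) //.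
rewrite -(mulr_natr (_ * _) (_ - _)%N) -(mulr_natr (tball n) (_ - _)%N).
rewrite -(mulr_natr _ (b ^ n)%N) natrB ?leq_exp2l // !natrX exprS.
have := bX_gt0 n; have b2 : (2 : R) <= b%:R by rewrite ler_nat.
have := xball_ge0 n; have := expR_gt0 (- lambda); have := b_gt0.
set q := expR _; set x := xball n; set t := tball n; set t' := tball n.+1.
set h := b%:R ^+ n; set B := b%:R : R => B0 q0 x0 h0 ineq.
have {}ineq : (B - 1) * (q * x) <= 2 * (B * t - t').
  rewrite -(ler_pM2r h0).
  have -> : (B - 1) * (q * x) * h = q * x * (B * h - h) by ring.
  apply: (le_trans ineq); rewrite le_eqVlt; apply/orP; left; apply/eqP; ring.
have -> : q * (x / h) = (B * (q * x)) / (B * h) by field; rewrite !gt_eqF.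
have -> : 4 * (t / h - t' / (B * h)) = 4 * (B * t - t') / (B * h) by field; rewrite !gt_eqF.
rewrite ler_pM2r ?invr_gt0 ?mulr_gt0 //.
have qx : 0 <= q * x by rewrite mulr_ge0 // ltW.
suff : 0 <= (B - 2) * (q * x) by move=> ?; lra.
by rewrite mulr_ge0 // subr_ge0.
Qed.

Lemma tball0 : tball 0 = 1.
Proof.
rewrite /tball (big_pred1 0) ?pconnxx // => v.
by rewrite inE leqn0 lev_eq0.
Qed.

Lemma xball0 : xball 0 = 1.
Proof.
rewrite /xball (big_pred1 0) ?pconnxx // => v.
by rewrite inE leqn0 lev_eq0.
Qed.

(** The drops of the density telescope from [tball 0 = 1] down to a nonnegative value. *)
Lemma sum_density L : (L <= m)%N ->
  \sum_(n < L) xball n / b%:R ^+ n <= 4 * expR lambda.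
Proof.
move=> Lm.
have H : expR (- lambda) * \sum_(n < L) xball n / b%:R ^+ n <=
    4 * (1 - tball L / b%:R ^+ L).
  elim: L Lm => [|L IH] Lm; first by rewrite big_ord0 mulr0 tball0 expr0 divr1 subrr mulr0.
  rewrite big_ord_recr /= mulrDr; have := IH (ltnW Lm); have := density_drop Lm; lra.
rewrite -(ler_pM2l (expR_gt0 (- lambda))) mulrCA -expRD addNr expR0 mulr1.
apply: (le_trans H); rewrite -[leRHS]mulr1 ler_pM2l // lerBlDr lerDl.
by rewrite divr_ge0 ?(ltW (bX_gt0 _)) // sumr_ge0 // => v _; apply/pconn_ge0/pedge01.
Qed.

Lemma exists_small_density L : (L <= m)%N -> 8 * lambda * expR lambda < L%:R ->
  exists2 n, (n < L)%N & lambda * xball n <= b%:R ^+ n / 2.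
Proof.
move=> Lm L_gt.
have [/existsP[n nS]|] := boolP [exists n : 'I_L, lambda * xball n <= b%:R ^+ n / 2].
  by exists n.
rewrite negb_exists => /forallP noN.
have := sum_density Lm; rewrite leNgt => /negP[].
(* If all [L] densities exceeded [1 / (2 lambda)], their sum would exceed [4 exp(lambda)] by the
   choice of [L]. *)
apply: (@lt_le_trans _ _ (\sum_(n < L) (2 * lambda)^-1)).
  rewrite sumr_const card_ord -(mulr_natl _ L) ltr_pdivlMr ?mulr_gt0 //.
  by apply: le_lt_trans L_gt; rewrite le_eqVlt; apply/orP; left; apply/eqP; ring.
apply: ler_sum => n _; have := noN n; rewrite -ltNge => lt_n.
rewrite ler_pdivlMr ?bX_gt0 // mulrC ler_pdivrMr ?mulr_gt0 //.
lra.
Qed.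

(** Sum Simon-Lieb for [ball n] over all endpoints. The smallness assumption bounds the exit term by
    half the susceptibility, which is finite in a box and can be absorbed; then [xball n <= b^n]. *)
Lemma susceptibility_le n : (n <= m)%N -> lambda * xball n <= b%:R ^+ n / 2 ->
  susceptibility <= 2 * b%:R ^+ n.
Proof.
move=> nm small; pose A := ball n.
have SL : susceptibility <= xball n + xball n * (lambda / b%:R ^+ n * susceptibility).
  have sumV v : \sum_x pconn pedge setT%SET v x = susceptibility.
    by rewrite (reindex_inj (@addrI _ v)) /=; apply: eq_bigr => x _; rewrite pconnT.
  have chi0 : 0 <= susceptibility by apply: sumr_ge0 => v _; apply/pconn_ge0/pedge01.
  have := @ler_sum _ _ (index_enum V) xpredT _ _
    (fun x _ => simon_lieb pedge01 x (ball0 n)).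
  move=> /le_trans; apply; rewrite big_split /= lerD //.
    rewrite (bigID (mem A)) /= [X in _ + X]big1 ?addr0 // => x xA.
    rewrite /pconn (@eq_bexp _ _ pedge _ (fun=> 0)) ?bexp_cst // => S.
    case: (boolP (conn _ _ _ _)) => // /conn_in; rewrite ball0 => /(_ isT).
    by rewrite -/A (negbTE xA).
  rewrite exchange_big mulr_suml; apply: ler_sum => u uA.
  rewrite exchange_big /=.
  rewrite (eq_bigr (fun v => pconn pedge (ball n) 0 u * (susceptibility * pedge [set u; v]%SET))); last first.
    by move=> v _; rewrite -!mulr_sumr sumV [susceptibility * _]mulrC.
  rewrite -!mulr_sumr ler_wpM2l ?pconn_ge0 //; first exact: pedge01.
  rewrite mulrC ler_wpM2r //; apply: le_trans (sum_rate_from nm uA).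
  apply: ler_sum => v; rewrite inE => vA; apply: pedge_le_rate.
  by apply: contraNneq vA => <-.
have hh := bX_gt0 n; have := xball_le nm.
have chi0 : 0 <= susceptibility by apply: sumr_ge0 => v _; apply/pconn_ge0/pedge01.
move: SL small hh chi0; set c := susceptibility; set x := xball n; set h := b%:R ^+ n.
move=> SL small hh chi0 xh.
have : x * (lambda / h * c) <= c / 2.
  have -> : x * (lambda / h * c) = (lambda * x) / h * c by field; rewrite gt_eqF.
  by rewrite [leRHS]mulrC ler_wpM2r // ler_pdivrMr // [leRHS]mulrC.
lra.
Qed.

(** * Lower bounds on the susceptibility of a box *)

Lemma cross_sibling_balls u v k : lev (v - u) = k.+1 ->
  bexp pedge (fun S => [disjoint S &
     cross [set u + z | z in ball k]%SET [set v + z | z in ball k]%SET]%:R) =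
  expR (- (lambda / b%:R)).
Proof.
move=> uvk; have km : (k < m)%N by rewrite -uvk lev_le.
(* All [b^(2k)] pairs between the two blocks are at level exactly [k+1], so the total rate is
   [b^(2k) * lambda * b^(1 - 2(k+1)) = lambda / b], whatever [k]. *)
have levE x y : x \in ball k -> y \in ball k -> lev (u + x - (v + y)) = k.+1.
  move=> xk yk; apply/eqP; rewrite eqn_leq levBC.
  have -> : v + y - (u + x) = (v - u) - (x - y) by rewrite opprB opprD addrACA.
  have xyk : x - y \in ball k by apply: ballB.
  rewrite (leq_trans (levB _ _)) /=; last first.
    by move: xyk; rewrite inE uvk geq_max leqnn /= => /leqW.
  rewrite ltnNge; apply/negP => le_k; have : v - u \in ball k.
    by rewrite -[v - u](subrK (x - y)) ballD // inE.
  by rewrite inE uvk ltnn.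
rewrite cross_expE; last first.
  rewrite -setI_eq0; apply/eqP/setP => w; rewrite in_setI in_set0; apply/negbTE/negP.
  case/andP => /imsetP[x xk ->] /imsetP[y yk xy]; have := levE x y xk yk.
  by rewrite xy subrr lev0.
congr (expR (- _)).
rewrite big_imset /=; last by move=> ? ? _ _; apply: addrI.
rewrite (eq_bigr (fun=> lambda / b%:R / b%:R ^+ k)); last first.
  move=> x xk; rewrite big_imset /=; last by move=> ? ? _ _; apply: addrI.
  rewrite (eq_bigr (fun=> lambda * (b%:R * (b%:R ^+ k.+1)^-1 ^+ 2))); last first.
    by move=> y yk; apply: rateE; exact: levE.
  rewrite sumr_const card_lev_le ?(ltnW km) // -(mulr_natl _ (b ^ k)%N) natrX (exprS _ k).
  by field; rewrite !gt_eqF.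
rewrite sumr_const card_lev_le ?(ltnW km) // -(mulr_natl _ (b ^ k)%N) natrX.
by field; rewrite !gt_eqF.
Qed.

(** The blocks compared are the largest ones that separate [u] from [v]. The predecessor is a true
    one, because distinct vertices have a difference of positive level. *)
Definition unlinked (S : {set {set V}}) u v : bool :=
  (u != v) && [disjoint S & cross [set u + z | z in ball (lev (v - u)).-1]%SET
                                  [set v + z | z in ball (lev (v - u)).-1]%SET].

(** Induction on the level of the difference: go inside the block of the first vertex to an edge
    linking the two sibling blocks, cross it, and continue inside the other block. *)
Lemma conn_all_linked S u v : (forall x y, ~~ unlinked S x y) -> conn S setT%SET u v.
Proof.
move=> linked; suff H k x y : (lev (y - x)%R <= k)%N -> conn S setT%SET x y.
  exact: (H m u v (lev_le _)).
elim: k x y => [|k IH] x y.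
  by rewrite leqn0 lev_eq0 subr_eq0 => /eqP ->; rewrite /conn connect0.
have [xyk _|ltk lek] := leqP (lev (y - x)) k; first exact: IH.
have xyE : lev (y - x) = k.+1 by apply/eqP; rewrite eqn_leq lek.
have xy : x != y by apply: contraTneq ltk => ->; rewrite subrr lev0.
move: (linked x y); rewrite /unlinked xy xyE /= -setI_eq0 => /set0Pn[e].
rewrite inE => /andP[eS /imsetP[[_ _] /setXP[/= /imsetP[z zk ->] /imsetP[w wk ->]] eE]].
apply: (@conn_trans _ _ _ (x + z)).
  by apply: IH; move: zk; rewrite inE addrC addKr.
apply: (@conn_trans _ _ _ (y + w)); first by apply: connect1; rewrite /edge !inE -eE.
by apply: IH; move: wk; rewrite inE opprD addNKr levN.
Qed.

(** Union bound over the [b^(2m)] ordered pairs of vertices for the event that some pair is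
    unlinked; outside it all [b^m] vertices are connected to 0. *)
Lemma susceptibility_ge : b%:R ^+ m * (1 - b%:R ^+ m ^+ 2 * expR (- (lambda / b%:R))) <=
  susceptibility.
Proof.
set q := expR _.
have ballT : ball m = setT%SET by apply/setP => v; rewrite !inE lev_le.
have cardV : #|V| = (b ^ m)%N by rewrite -(card_lev_le (leqnn m)) -cardsT -ballT.
have H v : 1 - b%:R ^+ m ^+ 2 * q <= pconn pedge setT%SET 0 v.
  have step S : 1 - \sum_x \sum_y (unlinked S x y)%:R <= (conn S setT%SET 0 v)%:R :> R.
    have [/existsP[x /existsP[y xy]]|] := boolP [exists x, exists y, unlinked S x y].
      rewrite (bigD1 x) //= (bigD1 y) //= xy.
      rewrite -addrA opprD addrA subrr add0r (@le_trans _ _ 0) // oppr_le0.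
      by rewrite addr_ge0 //; do ?[apply: sumr_ge0 => ? _].
    rewrite negb_exists => /forallP nu; rewrite conn_all_linked ?lerBlDr ?lerDl.
      by do 2 apply: sumr_ge0 => ? _.
    by move=> x y; move: (nu x); rewrite negb_exists => /forallP.
  have := le_bexp pedge01 step; apply: le_trans.
  rewrite bexpB bexp_cst lerB // bexp_sum.
  apply: (@le_trans _ _ (\sum_(x : V) \sum_(y : V) q)); last first.
    rewrite !sumr_const !cardV -mulrnA -(mulr_natl _ (b ^ m * b ^ m)%N) natrM natrX -expr2 //.
  apply: ler_sum => x _; rewrite bexp_sum; apply: ler_sum => y _.
  have [->|xy] := eqVneq x y.
    rewrite (@eq_bexp _ _ pedge _ (fun=> 0)) ?bexp_cst ?expR_ge0 // => S.
    by rewrite /unlinked eqxx.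
  rewrite /unlinked xy /=; case E: (lev (y - x)) => [|k].
    by move/eqP: E; rewrite lev_eq0 subr_eq0 eq_sym (negbTE xy).
  by rewrite (cross_sibling_balls E).
rewrite -natrX -cardV mulr_natl -sumr_const; apply: ler_sum => v _; rewrite cardV natrX; exact: H.
Qed.

(** Count only 0 and one vertex of level 1, reached by its direct edge of rate [lambda / b]. This
    serves for bounded [lambda], where the union bound is too weak. *)
Lemma susceptibility_ge_deg : (0 < m)%N -> 2 - expR (- (lambda / b%:R)) <= susceptibility.
Proof.
move=> m_gt0; have : (0 < #|[set v | lev v == 1%N]%SET|)%N.
  by rewrite card_sphere // subn_gt0 ltn_exp2l.
case/card_gt0P => x; rewrite inE => /eqP x1.
have x0 : x != 0 by rewrite -lev_eq0 x1.
rewrite /susceptibility (bigD1 0) //= (bigD1 x) //= pconnxx.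
have H : 1 - expR (- (lambda / b%:R)) <= pconn pedge setT%SET 0 x.
  have -> : 1 - expR (- (lambda / b%:R)) = pedge [set 0; x]%SET.
    rewrite pedge2 1?eq_sym // (@rateE _ 1) ?sub0r ?levN // expr1.
    by congr (1 - expR (- _)); field; rewrite gt_eqF.
  rewrite -(bexp_in pedge); apply: le_bexp => [|S]; first exact: pedge01.
  case xS: (_ \in S) => //; rewrite /conn connect1 //.
  by rewrite /edge !inE.
have : 0 <= \sum_(i | (i != 0) && (i != x)) pconn pedge setT%SET 0 i.
  by apply: sumr_ge0 => v _; apply/pconn_ge0/pedge01.
lra.
Qed.

End HierarchicalPercolation.

(* Imported only now: [classical_sets] shadows the [finset] names used above. *)
From mathcomp Require Import finmap.
From mathcomp Require Import all_classical all_reals all_analysis.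
From mathcomp Require Import measurable_realfun.
Import Order.TTheory GRing.Theory Num.Theory.
Local Open Scope ring_scope.

(** * Finite boxes in the hierarchical group *)

Section Levels.
Variable b : nat.
Hypothesis b_gt1 : (1 < b)%N.

Lemma hdistE (x y : Gam b) : hdist x y = size (x - y).
Proof.
apply/eqP; rewrite eqn_leq; apply/andP; split.
  apply/bigmax_leqP => i xyi; rewrite ltnNge; apply: contra xyi => le_i.
  by rewrite -subr_eq0 -coefB nth_default.
case E: (size (x - y)) => [//|k].
have kxy : (k < maxn (size x) (size y))%N.
  by rewrite -E (leq_trans (size_polyD _ _)) // size_polyN.
rewrite /hdist (bigD1 (Ordinal kxy)) /= ?leq_maxl //.
rewrite -subr_eq0 -coefB; have := lead_coef_eq0 (x - y).
by rewrite lead_coefE E /= => ->; rewrite -size_poly_eq0 E.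
Qed.

Variable m : nat.
Implicit Types u v : 'rV['Z_b]_m.

(** The box of sequences supported on the first [m] coordinates is the finite group ['rV['Z_b]_m],
    embedded in [Gam b] by [rVpoly]. By [hdistE], [vlev] is the hierarchical distance to 0. *)
Definition vlev v : nat := size (rVpoly v).

Lemma vlev_eq0 v : (vlev v == 0%N) = (v == 0).
Proof. by rewrite size_poly_eq0 -(inj_eq (can_inj rVpolyK)) linear0. Qed.

Lemma vlevB u v : (vlev (u - v)%R <= maxn (vlev u) (vlev v))%N.
Proof. by rewrite /vlev linearB (leq_trans (size_polyD _ _)) // size_polyN. Qed.

Lemma vlev_le v : (vlev v <= m)%N.
Proof. exact: size_poly. Qed.

Lemma card_vlev_le n : (n <= m)%N -> #|[set v | (vlev v <= n)%N]%SET| = (b ^ n)%N.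
Proof.
move=> nm; transitivity #|{: 'rV['Z_b]_n}|; last first.
  by rewrite card_mx mul1n card_ord Zp_cast.
pose f (w : 'rV['Z_b]_n) : 'rV['Z_b]_m := poly_rV (rVpoly w).
have fK w : rVpoly (f w) = rVpoly w.
  by rewrite poly_rV_K // (leq_trans (size_poly _ _)).
rewrite -(@card_imset _ _ f); last first.
  by move=> w w' ff; apply: (can_inj rVpolyK); rewrite -fK ff fK.
apply: eq_card => v; rewrite !inE; apply/idP/imsetP => [vn|[w _ ->]].
  by exists (poly_rV (rVpoly v)) => //; rewrite /f poly_rV_K ?rVpolyK.
by rewrite /vlev fK size_poly.
Qed.

End Levels.

Lemma upair0_card (b : nat) : #|` [fset (0 : Gam b); 1]%fset| == 2%N.
Proof. by rewrite cardfs2 [0 == _]eq_sym oner_eq0. Qed.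

(** * The law of the set of open edges in a box *)

Section OpenEdges.
Local Open Scope classical_set_scope.
Variables (R : realType) (b : nat) (lambda : R).
Hypothesis b_gt1 : (1 < b)%N.
Hypothesis lambda_gt0 : 0 < lambda.
Variables (d : measure_display) (Omega : measurableType d) (P : probability Omega R).
Variable N : upair (Gam b) -> {RV P >-> nat}.
Hypothesis HN : hierarchical_multigraph lambda N.
Variable m : nat.
Notation V := 'rV['Z_b]_m.
Implicit Types (e : {set V}) (u v : V).

Notation wedge := (pedge (@vlev b m) b lambda).

(* The default value is only reached when [e] is not a pair. *)
Definition upair_of e : upair (Gam b) :=
  insubd (exist (fun A : {fset Gam b} => #|` A| == 2%N) _ (upair0_card b))
    [fset rVpoly v | v in e]%fset.

Definition open_edges (w : Omega) : {set {set V}} :=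
  [set e : {set V} | (#|e| == 2%N) && (0 < N (upair_of e) w)%N]%SET.

Let rVpoly_inj : injective (@rVpoly 'Z_b m). Proof. exact: can_inj rVpolyK. Qed.

Lemma val_upair_of e : #|e| = 2%N -> val (upair_of e) = [fset rVpoly v | v in e]%fset.
Proof.
move=> e2; rewrite val_insubd card_imfset //= -e2.
by rewrite -cardE eqxx.
Qed.

Lemma val_upair_of2 u v : u != v ->
  val (upair_of [set u; v]%SET) = [fset rVpoly u; rVpoly v]%fset.
Proof.
move=> uv; rewrite val_upair_of ?cards2 ?uv //; apply/fsetP => x; rewrite !inE.
apply/imfsetP/orP => [[w /=]|].
  by rewrite !inE => /orP[]/eqP -> ->; [left | right].
by case=> /eqP ->; [exists u | exists v]; rewrite //= !inE eqxx ?orbT.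
Qed.

Lemma upair_of_inj e e' : #|e| = 2%N -> #|e'| = 2%N -> upair_of e = upair_of e' -> e = e'.
Proof.
move=> e2 e'2 ee'; have /fsetP E : [fset rVpoly v | v in e]%fset = [fset rVpoly v | v in e']%fset.
  by rewrite -!val_upair_of // ee'.
apply/setP => v; have := E (rVpoly v).
by rewrite !mem_imfset.
Qed.

Lemma vlev_hdist u v : hdist (rVpoly u : Gam b) (rVpoly v) = vlev (u - v).
Proof. by rewrite hdistE // /vlev linearB. Qed.

Lemma measurable_count e (A : set nat) : measurable (N (upair_of e) @^-1` A).
Proof. exact: measurable_funPTI. Qed.

Lemma P_closed e : #|e| = 2%N ->
  P (N (upair_of e) @^-1` [set 0%N]) = (1 - wedge e)%:E.
Proof.
move=> /eqP/cards2P[u [v [uv ->]]].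
have := HN.2 (rVpoly u) (rVpoly v) _ (val_upair_of2 uv) 0%N.
rewrite /poisson_pmf vlev_hdist -/(rate (@vlev b m) b lambda (u - v)).
rewrite rate_gt0 // expr0 fact0 invr1 !mul1r => E.
by rewrite pedge2 ?subKr //; [exact: vlev_eq0 | exact: vlevB].
Qed.

Lemma P_open e : #|e| = 2%N ->
  P (N (upair_of e) @^-1` [set k | (0 < k)%N]) = (wedge e)%:E.
Proof.
move=> e2; have -> : N (upair_of e) @^-1` [set k | (0 < k)%N] =
    ~` (N (upair_of e) @^-1` [set 0%N]).
  by apply/seteqP; split => w /=; rewrite lt0n => /eqP.
rewrite probability_setC ?P_closed //; last exact: measurable_count.
by rewrite -EFinB subKr.
Qed.

Definition pairs : {fset {set V}} := [fset e in enum {set V} | #|e| == 2%N]%fset.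

(** If [S] contains a set that is not a pair, both sides vanish since [pedge] is 0 there. Otherwise
    the event prescribes, for each pair of the box, whether its multiplicity is zero, and
    independence gives the product. *)
Lemma P_open_edges (S : {set {set V}}) :
  measurable [set w | open_edges w = S] /\
  P [set w | open_edges w = S] = (bwt wedge S)%:E.
Proof.
have [/existsP[e /andP[eS e2]]|] := boolP [exists e in S, #|e| != 2%N].
  have -> : [set w | open_edges w = S] = set0.
    apply/seteqP; split => w //= wS; move: eS; rewrite -wS inE (negbTE e2).
    by [].
  split=> //; rewrite measure0 /bwt (bigD1 e) //= eS /pedge (negbTE e2) mul0r //.
rewrite negb_exists => /forallP S2.
have {}S2 e : e \in S -> #|e| = 2%N.
  by move=> eS; have := S2 e; rewrite eS /= negbK => /eqP.
pose J : {fset upair (Gam b)} := [fset upair_of e | e in pairs]%fset.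
pose U : {fset upair (Gam b)} := [fset upair_of e | e in S]%fset.
pose A (i : upair (Gam b)) : set nat := if i \in U then [set k | (0 < k)%N] else [set 0%N].
have inU e : #|e| = 2%N -> (upair_of e \in U) = (e \in S).
  move=> e2; apply/imfsetP/idP => [[e' /= e'S ee']|eS]; last by exists e.
  by rewrite (upair_of_inj e2 (S2 _ e'S) ee').
have inpairs e : (e \in pairs) = (#|e| == 2%N).
  by rewrite !inE /= mem_enum.
have E : [set w | open_edges w = S] = \bigcap_(i in [set` J]) (N i @^-1` A i).
  apply/seteqP; split => w /=.
    move=> wS i /imfsetP[e /= ep ->]; rewrite inpairs in ep.
    rewrite /A /preimage inU ?(eqP ep) // -wS inE ep /=.
    by case: (posnP (N (upair_of e) w)) => //=.
  move=> wA; apply/setP => e; rewrite inE; case: eqP => [e2|e2] /=; last first.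
    by apply/esym/negbTE/negP => /S2.
  have eJ : upair_of e \in J by apply/imfsetP; exists e => //=; rewrite inpairs e2.
  by move: (wA _ eJ); rewrite /A inU //=; case: (e \in S) => //= ->.
split.
  rewrite E; apply: fin_bigcap_measurable => // i /imfsetP[e _ ->].
  exact: measurable_count.
rewrite E (HN.1 J A) //.
rewrite big_imfset /=; last first.
  by move=> e e'; rewrite !inpairs => /eqP e2 /eqP e'2; apply: upair_of_inj.
transitivity (\prod_(e <- pairs) (if e \in S then wedge e else 1 - wedge e)%:E)%E.
  rewrite big_seq [RHS]big_seq; apply: eq_bigr => e; rewrite inpairs => /eqP e2.
  by rewrite /A inU //; case: ifP => _; rewrite ?P_open ?P_closed.
rewrite prodEFin; congr (_%:E); rewrite /bwt.
(* Sets that are not pairs are closed with probability 1 and contribute a factor 1 to [bwt]. *)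
rewrite [RHS](bigID (mem pairs)) /= [X in _ = _ * X]big1 ?mulr1; last first.
  move=> e; rewrite inpairs => e2; rewrite /pedge (negbTE e2) subr0.
  by case: ifP => // /S2 eS2; rewrite eS2 in e2.
rewrite -[RHS]big_filter; apply: perm_big; apply: uniq_perm => [||e].
- exact: fset_uniq.
- by rewrite filter_uniq // index_enum_uniq.
- by rewrite mem_filter mem_index_enum andbT.
Qed.

Lemma integral_open_edges (g : {set {set V}} -> R) : (forall S, 0 <= g S) ->
  measurable_fun [set: Omega] (fun w => (g (open_edges w))%:E) /\
  (\int[P]_w (g (open_edges w))%:E)%E = (bexp wedge g)%:E.
Proof.
move=> g0; pose F (S : {set {set V}}) := [set w | open_edges w = S].
have mF S : measurable (F S) by have [] := P_open_edges S.
have gE : (fun w => (g (open_edges w))%:E) =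
    (fun w => \sum_(S : {set {set V}}) ((g S)%:E * (\1_(F S) w)%:E))%E.
  apply/funext => w; rewrite (bigD1 (open_edges w)) //= big1 ?adde0; last first.
    move=> S Sw; rewrite indicE memNset ?mule0 // /F /= => SE.
    by move: Sw; rewrite SE eqxx.
  by rewrite indicE mem_set ?mule1.
have mg S : measurable_fun [set: Omega] (fun w => ((g S)%:E * (\1_(F S) w)%:E)%E).
  apply: measurable_funeM; apply/measurable_EFinP; exact: measurable_indic.
split.
  by rewrite gE; apply: emeasurable_sum.
rewrite gE ge0_integral_sum //; last first.
  by move=> S w _; rewrite mule_ge0 ?lee_fin.
rewrite /bexp -sumEFin; apply: eq_bigr => S _.
rewrite ge0_integralZl //; last 2 first.
- by apply/measurable_EFinP; exact: measurable_indic.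
- by rewrite lee_fin.
have [_ PS] := P_open_edges S; rewrite mulrC EFinM; congr (_ * _)%E.
by rewrite integral_indic // setIT; exact: PS.
Qed.

End OpenEdges.

Lemma connect_homo (T T' : finType) (e : rel T) (e' : rel T') (f : T -> T') x y :
  (forall u v, e u v -> e' (f u) (f v)) -> connect e x y -> connect e' (f x) (f y).
Proof.
move=> ee' /connectP[q]; elim: q x => [|z q IH] x /=; first by move=> _ ->.
case/andP => xz zq yE; apply: connect_trans (IH _ zq yE).
exact/connect1/ee'.
Qed.

(** * The component of 0 as the increasing limit of its clusters in boxes *)

Section ClusterSize.
Local Open Scope classical_set_scope.
Variables (R : realType) (b : nat) (lambda : R).
Hypothesis b_gt1 : (1 < b)%N.
Hypothesis lambda_gt0 : 0 < lambda.
Variables (d : measure_display) (Omega : measurableType d) (P : probability Omega R).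
Variable N : upair (Gam b) -> {RV P >-> nat}.
Hypothesis HN : hierarchical_multigraph lambda N.

Definition box_cluster m (w : Omega) : {set 'rV['Z_b]_m} :=
  open_cluster (open_edges N m w) [set: _]%SET 0.

Notation comp w := (component (fun e => N e w) (0 : Gam b)).

Notation chi_box m := (susceptibility (@vlev b m) b lambda).

Lemma adj_edge m (w : Omega) (u v : 'rV['Z_b]_m) :
  adj (fun e => N e w) (rVpoly u : Gam b) (rVpoly v) =
  edge (open_edges N m w) [set: _]%SET u v.
Proof.
rewrite /edge !inE /=; apply/asboolP/andP => [[e [eE Ne]]|[uv Nuv]].
  have uv : u != v.
    by apply/eqP => uv; have := valP e; rewrite /= eE uv fsetUid cardfs1.
  split; first by rewrite cards2 uv.
  suff -> : upair_of [set u; v]%SET = e by [].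
  by apply: val_inj; rewrite eE val_upair_of2.
exists (upair_of [set u; v]%SET); split => //.
apply: val_upair_of2; apply: contraTneq uv => ->.
by rewrite finset.setUid cards1.
Qed.

Lemma box_cluster_sub m w v : v \in box_cluster m w -> comp w (rVpoly v).
Proof.
rewrite inE => /connectP[q q0 ->]; exists (map (fun u => rVpoly u : Gam b) q).
  rewrite -(linear0 (@rVpoly _ m)) path_map; apply: sub_path q0 => x y /=.
  by rewrite adj_edge.
by rewrite -(linear0 (@rVpoly _ m)) last_map.
Qed.

(** A path has finitely many vertices, so it lies in every box longer than all their supports. *)
Lemma comp_box_cluster w x : comp w x ->
  exists m0, forall m, (m0 <= m)%N -> (size x <= m)%N /\ poly_rV x \in box_cluster m w.
Proof.
case=> q q0 ->; exists (\max_(y <- q) size y)%N => m qm.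
have {}qm y : y \in q -> (size y <= m)%N.
  by move=> yq; apply: leq_trans qm; exact: (@leq_bigmax_seq _ q xpredT (fun z : Gam b => size z) y yq isT).
rewrite inE -[X in conn _ _ X](linear0 (@poly_rV _ m)).
have : (size (0%R : Gam b) <= m)%N by rewrite size_poly0.
move: q0; move: (0 : Gam b) => z; elim: q z qm => [|y q IH] z qm /=.
  by move=> _ zm; split => //; rewrite /conn connect0.
case/andP => zy yq zm.
have ym : (size y <= m)%N by apply: qm; rewrite mem_head.
have [|//|lm yl] := IH y _ yq; first by move=> t tq; apply: qm; rewrite inE tq orbT.
split=> //; apply: connect_trans yl; apply: connect1.
by rewrite -adj_edge !poly_rV_K.
Qed.

Lemma rVpoly_widen m n (u : 'rV['Z_b]_m) : (m <= n)%N ->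
  rVpoly (poly_rV (rVpoly u) : 'rV_n) = rVpoly u.
Proof. by move=> mn; rewrite poly_rV_K // (leq_trans (size_poly _ _)). Qed.

Lemma box_cluster_widen w m n (u : 'rV['Z_b]_m) : (m <= n)%N ->
  u \in box_cluster m w -> poly_rV (rVpoly u) \in box_cluster n w.
Proof.
move=> mn; rewrite !inE.
have -> : 0 = poly_rV (rVpoly (0 : 'rV['Z_b]_m)) :> 'rV_n by rewrite !linear0.
apply: (connect_homo (f := fun v => poly_rV (rVpoly v))) => x y.
by rewrite -!adj_edge !rVpoly_widen.
Qed.

Lemma card_box_cluster_le w m n : (m <= n)%N ->
  (#|box_cluster m w| <= #|box_cluster n w|)%N.
Proof.
move=> mn; rewrite -(@card_imset _ _ (fun u => poly_rV (rVpoly u) : 'rV_n)); last first.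
  by move=> u u' ff; apply: (can_inj rVpolyK); rewrite -(rVpoly_widen u mn) ff rVpoly_widen.
apply/subset_leq_card/fintype.subsetP => _ /imsetP[u uc ->].
exact: box_cluster_widen.
Qed.

(** Every finite part of the component lies in the cluster of a single box, and every box cluster
    embeds in the component. *)
Lemma counting_component w :
  counting (comp w) = ereal_sup (range (fun m => (#|box_cluster m w|%:R%:E : \bar R))).
Proof.
have finA (D : {fset Gam b}) : [set` D] `<=` comp w ->
    exists m, (#|` D| <= #|box_cluster m w|)%N.
  move=> Dc.
  have [m Dm] : exists m, forall x, x \in D ->
      (size x <= m)%N /\ poly_rV x \in box_cluster m w.
    elim/finSet_rect : D Dc => D IH Dc.
    have [->|[x xD]] := fset_0Vmem D; first by exists 0%N.
    have [||m1 H1] := IH (D `\ x)%fset; first exact: fproperD1.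
      by move=> y /=; rewrite !inE => /andP[_ yD]; exact: Dc.
    have [m2 H2] := comp_box_cluster (Dc _ xD).
    exists (maxn m1 m2) => y yD; have [->|yx] := eqVneq y x.
      by apply: H2; rewrite leq_maxr.
    have [y1 y2] : (size y <= m1)%N /\ poly_rV y \in box_cluster m1 w.
      by apply: H1; rewrite !inE yx.
    split; first by rewrite leq_max y1.
    by rewrite -[X in poly_rV X](poly_rV_K y1); apply: box_cluster_widen y2; rewrite leq_maxl.
  exists m; rewrite cardfE -(@card_imset _ _ (fun x : D => poly_rV (val x) : 'rV['Z_b]_m)).
    apply/subset_leq_card/fintype.subsetP => _ /imsetP[x _ ->].
    by have [] := Dm (val x) (valP x).
  move=> x y xy; apply: val_inj.
  have [xm _] := Dm _ (valP x); have [ym _] := Dm _ (valP y).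
  by rewrite -(poly_rV_K xm) xy poly_rV_K.
apply/eqP; rewrite eq_le; apply/andP; split.
  rewrite /counting; case: asboolP => [fin|inf].
    have [|m Dm] := finA (fset_set (comp w)); first by rewrite fset_setK.
    apply: le_trans (ereal_sup_ubound _); last by exists m.
    by rewrite lee_fin ler_nat.
  rewrite leNgt; apply/negP => sup_lt.
  have [s0] : exists s : R, (ereal_sup (range (fun m => (#|box_cluster m w|%:R%:E : \bar R))) <= s%:E)%E.
    move: sup_lt; case: (ereal_sup _) => [s| |] // _; [by exists s | by exists 0; rewrite leNye].
  move=> sup_le.
  (* An infinite component contains a finite set with more than [s0] elements, which some box
     cluster must accommodate, contradicting the bound [s0]. *)
  have [D Dc Ds] := infinite_set_fset (Num.truncn s0).+1 inf.
  have [m Dm] := finA D Dc.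
  have : ((#|box_cluster m w|%:R : R)%:E <= s0%:E)%E.
    by apply: le_trans sup_le; apply: ereal_sup_ubound; exists m.
  rewrite lee_fin leNgt => /negP[].
  by apply: lt_le_trans (truncnS_gt s0) _; rewrite ler_nat (leq_trans Ds).
apply: ge_ereal_sup => _ [m _ <-]; rewrite /counting; case: asboolP => [fin|]; last by rewrite leey.
rewrite lee_fin ler_nat.
pose B := [fset (rVpoly v : Gam b) | v in box_cluster m w]%fset.
have <- : #|` B| = #|box_cluster m w| by rewrite card_imfset ?cardE //; exact: can_inj rVpolyK.
apply/fsubset_leq_card/fsubsetP => _ /imfsetP[v /= vc ->].
by rewrite in_fset_set // inE; exact: box_cluster_sub.
Qed.

Lemma integral_box_cluster m :
  measurable_fun [set: Omega] (fun w => (#|box_cluster m w|%:R : R)%:E) /\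
  (\int[P]_w (#|box_cluster m w|%:R : R)%:E)%E = (chi_box m)%:E.
Proof.
have [mS intS] := integral_open_edges b_gt1 lambda_gt0 HN
  (g := fun S => #|open_cluster S [set: 'rV['Z_b]_m]%SET 0|%:R) (fun=> ler0n _ _).
split=> //; rewrite intS; congr (_%:E).
rewrite /susceptibility /pconn -bexp_sum; apply: eq_bexp => S.
rewrite -sum1_card natr_sum big_mkcond /=; apply: eq_bigr => v _.
by rewrite inE; case: conn.
Qed.

(** Monotone convergence, since the box clusters grow with [m]. *)
Lemma cvg_chi_box : (fun m => (chi_box m)%:E) @ \oo --> chi N.
Proof.
have -> : (fun m => (chi_box m)%:E) = (fun m => \int[P]_w (#|box_cluster m w|%:R : R)%:E)%E.
  by apply/funext => m; have [_ ->] := integral_box_cluster m.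
rewrite /chi; have -> : (fun w => counting (comp w)) =
    (fun w => limn (fun m => (#|box_cluster m w|%:R%:E : \bar R))).
  apply/funext => w; rewrite counting_component; apply/esym/cvg_lim => //.
  apply: ereal_nondecreasing_cvgn => m n mn; rewrite lee_fin ler_nat.
  exact: card_box_cluster_le.
apply: cvg_monotone_convergence => //.
- by move=> m; exact: (integral_box_cluster m).1.
- by move=> w _ m n mn; rewrite lee_fin ler_nat card_box_cluster_le.
Qed.

Lemma chi_box_nondecreasing : {homo (fun m => chi_box m) : m n / (m <= n)%N >-> m <= n}.
Proof.
move=> m n mn; rewrite -lee_fin.
have [mm <-] := integral_box_cluster m; have [mn' <-] := integral_box_cluster n.
apply: ge0_le_integral => // w _; rewrite lee_fin ler_nat.
exact: card_box_cluster_le.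
Qed.

Lemma chi_box_le m : ((chi_box m)%:E <= chi N)%E.
Proof.
have := cvg_chi_box.
move=> /cvg_lim <- //; apply: lime_ge.
  by apply/cvg_ex; exists (chi N); exact: cvg_chi_box.
by exists m => // n /= mn; rewrite lee_fin chi_box_nondecreasing.
Qed.

Lemma chi_le_box m0 K : (forall m, (m0 <= m)%N -> chi_box m <= K) -> (chi N <= K%:E)%E.
Proof.
move=> HK; have /cvg_lim <- // := cvg_chi_box.
apply: lime_le.
  by apply/cvg_ex; exists (chi N); exact: cvg_chi_box.
by exists m0 => // m /= mm; rewrite lee_fin HK.
Qed.

End ClusterSize.

(** * Numerical estimates *)

Section Bounds.
Variables (R : realType) (b : nat).
Hypothesis b_gt1 : (1 < b)%N.

Notation B := (b%:R : R).
Notation chi_box lambda m := (susceptibility (@vlev b m) b (lambda : R)).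

Let B_ge2 : 2 <= B. Proof. by rewrite ler_nat. Qed.

Let natX_le_exp n : B ^+ n <= expR (B * n%:R).
Proof.
rewrite mulrC expRM_natl lerXn2r ?nnegrE ?expR_ge0 //.
by apply: le_trans (expR_ge1Dx B); rewrite lerDr.
Qed.

Let two_le_exp1 : 2 <= expR 1 :> R.
Proof. by have := expR_ge1Dx (1 : R). Qed.

Let exp_half_le2 : expR (2^-1) <= 2 :> R.
Proof.
have h : 2^-1 <= expR (- 2^-1) :> R by have := expR_ge1Dx (- 2^-1 : R); lra.
by rewrite -[leLHS]invrK -expRN -[leRHS]invrK lef_pV2 ?posrE ?expR_gt0.
Qed.

(** With [x = lambda / (64 b^2)] and [y = lambda / b], the claim [exp x < 2 - exp(-y)] follows from
    [exp x <= 1/(1-x)] and [exp(-y) <= 1/(1+y)], because [x < 3/8] and [128 x <= y]. *)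
Lemma chi_box_small (lambda : R) : 0 < lambda -> lambda < 24 * B ^+ 2 ->
  expR (lambda / (64 * B ^+ 2)) < chi_box lambda 1.
Proof.
move=> l0 lB; have B2 := B_ge2; have B0 : 0 < B by rewrite ltr0n ltnW.
have := susceptibility_ge_deg b_gt1 l0 (@vlev_eq0 b 1) (@vlevB b 1)
  (card_vlev_le b_gt1 (m := 1)) isT.
apply: lt_le_trans.
set x := lambda / (64 * B ^+ 2); set y := lambda / B.
have y0 : 0 < y by rewrite divr_gt0.
have xE : x * (64 * B) = y by rewrite /x /y; field; rewrite gt_eqF.
have x38 : x < 3 / 8 by rewrite /x ltr_pdivrMr ?mulr_gt0 ?exprn_gt0 //; lra.
have x0 : 0 < x by rewrite divr_gt0 // mulr_gt0 // exprn_gt0.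
have xy : x * 128 <= y by rewrite -xE ler_pM2l //; lra.
have Ex : expR x <= (1 - x)^-1.
  rewrite -[leLHS]invrK -expRN lef_pV2 ?posrE ?expR_gt0 ?subr_gt0 //; last by lra.
  by have := expR_ge1Dx (- x).
have Ey : expR (- y) <= (1 + y)^-1.
  rewrite expRN lef_pV2 ?posrE ?expR_gt0 ?addr_gt0 //.
  exact: expR_ge1Dx.
suff : (1 - x)^-1 + (1 + y)^-1 < 2 by lra.
have -> : (1 - x)^-1 + (1 + y)^-1 = (2 + y - x) / ((1 - x) * (1 + y)).
  by field; rewrite !gt_eqF //; lra.
rewrite ltr_pdivrMr; last by rewrite mulr_gt0 //; lra.
have : 0 < (3 / 8 - x) * y by rewrite mulr_gt0 // subr_gt0.
nra.
Qed.

Lemma chi_box_large (lambda : R) : 24 * B ^+ 2 <= lambda ->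
  exists m, expR (lambda / (64 * B ^+ 2)) < chi_box lambda m.
Proof.
move=> lB; have B2 := B_ge2; have B0 : 0 < B by rewrite ltr0n ltnW.
have BB0 : 0 < B ^+ 2 by rewrite exprn_gt0.
have l0 : 0 < lambda by apply: lt_le_trans lB; rewrite mulr_gt0.
(* This [m] makes [b^(2m) <= exp(2bm) <= exp(lambda/(2b))], so the union bound costs at most
   [exp(-lambda/(2b)) <= 1/2]. Then [b^m / 2 >= exp(m/2 - 1)], which exceeds [exp(t/16)] as
   [t >= 6]. *)
pose t := lambda / (4 * B ^+ 2); pose m := Num.truncn t.
have t6 : 6 <= t by rewrite /t ler_pdivlMr ?mulr_gt0 //; lra.
have m_le : m%:R <= t by rewrite truncn_le // (le_trans _ t6).
have m_gt : t < m%:R + 1 by rewrite natr1; exact: truncnS_gt.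
exists m.
have := susceptibility_ge b_gt1 l0 (@vlev_eq0 b m) (@vlevB b m) (@vlev_le b m)
  (card_vlev_le b_gt1 (m := m)).
apply: lt_le_trans.
have half : 1 / 2 <= 1 - B ^+ m ^+ 2 * expR (- (lambda / B)).
  suff : B ^+ m ^+ 2 * expR (- (lambda / B)) <= 1 / 2 by lra.
  have H : B ^+ m ^+ 2 <= expR (lambda / B / 2).
    rewrite -exprM; apply: le_trans (natX_le_exp _) _; rewrite ler_expR natrM.
    have -> : lambda / B / 2 = B * (t * 2) by rewrite /t; field; rewrite gt_eqF.
    by rewrite ler_pM2l // ler_pM2r.
  apply: (@le_trans _ _ (expR (lambda / B / 2) * expR (- (lambda / B)))).
    by rewrite ler_pM2r ?expR_gt0.
  rewrite -expRD.
  have -> : lambda / B / 2 - lambda / B = - (lambda / B / 2) by lra.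
  rewrite expRN div1r lef_pV2 ?posrE ?expR_gt0 //.
  apply: (le_trans two_le_exp1); rewrite ler_expR.
  rewrite !ler_pdivlMr // mul1r; apply: le_trans _ lB.
  by rewrite expr2; nra.
have H2 : expR (m%:R / 2) <= B ^+ m.
  rewrite expRM_natl lerXn2r ?nnegrE ?expR_ge0 ?(ltW B0) //.
  by apply: (le_trans exp_half_le2).
have Bm0 : 0 < B ^+ m by rewrite exprn_gt0.
apply: (@lt_le_trans _ _ (B ^+ m * (1 / 2))); last by rewrite ler_pM2l.
apply: (@lt_le_trans _ _ (expR (m%:R / 2 - 1))); last first.
  rewrite expRD ler_pM ?expR_ge0 // expRN div1r lef_pV2 ?posrE ?expR_gt0 //.
rewrite ltr_expR.
have -> : lambda / (64 * B ^+ 2) = t / 16 by rewrite /t; field; rewrite gt_eqF.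
lra.
Qed.

Lemma chi_box_lower (lambda : R) : 0 < lambda ->
  exists m, expR (lambda / (64 * B ^+ 2)) < chi_box lambda m.
Proof.
move=> l0; have [|] := ltP lambda (24 * B ^+ 2); last exact: chi_box_large.
by exists 1%N; exact: chi_box_small.
Qed.

Lemma chi_box_upper (lambda : R) : 0 < lambda ->
  exists m0 K, K < expR (expR ((18 * B + 2) * lambda)) /\
    forall m, (m0 <= m)%N -> chi_box lambda m <= K.
Proof.
move=> l0; have B2 := B_ge2; have B0 : 0 < B by rewrite ltr0n ltnW.
have C0 : 0 < (18 * B + 2) * lambda by rewrite mulr_gt0 // addr_gt0 ?mulr_gt0.
have bound m n : (n <= m)%N -> lambda * xball (@vlev b m) b lambda n <= B ^+ n / 2 ->
    chi_box lambda m <= 2 * B ^+ n.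
  exact: (susceptibility_le b_gt1 l0 (@vlev_eq0 b m) (@vlevB b m) (@vlev_le b m)
    (card_vlev_le b_gt1 (m := m))).
have [l_small|l_large] := leP lambda (1 / 2).
  (* For [lambda <= 1/2] the radius 0 already has small density, since [xball 0 = 1]. *)
  exists 0%N, 2; split.
    by apply: (le_lt_trans two_le_exp1); rewrite ltr_expR -[ltLHS]expR0 ltr_expR.
  move=> m _; rewrite -[leRHS]mulr1 -[X in _ * X](expr0 B); apply: bound => //.
  by rewrite xball0 ?mulr1 ?expr0 //; exact: vlev_eq0.
(* The least integer strictly above the threshold of [exists_small_density]. *)
pose L := (Num.truncn (8 * lambda * expR lambda)).+1.
have el1 : 1 <= expR lambda by rewrite -[leLHS]expR0 ler_expR ltW.
have L_gt : 8 * lambda * expR lambda < L%:R by exact: truncnS_gt.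
have L_le : L%:R <= 8 * lambda * expR lambda + 1.
  by rewrite /L -natr1 lerD2r truncn_le // !mulr_ge0 ?expR_ge0 // ltW.
exists L, (2 * B ^+ L); split.
  apply: (@le_lt_trans _ _ (expR (1 + B * L%:R))).
    by rewrite expRD ler_pM // exprn_ge0 // ltW.
  rewrite ltr_expR.
  (* From [L <= 8 lambda exp(lambda) + 1] and [lambda < exp(lambda)]. The factor [1 + 9b] is then
     absorbed as [exp(9b) <= exp(18 b lambda)], using [lambda > 1/2]. *)
  apply: (@lt_le_trans _ _ ((1 + 9 * B) * (expR lambda * expR lambda))).
    have lel : lambda < expR lambda by have := expR_ge1Dx lambda; lra.
    move: L_le lel el1 B0 l0; set q := expR lambda; set l := L%:R => L_le lel el1 B0 l0.
    have h1 : B * l <= B * (8 * lambda * q + 1) by rewrite ler_pM2l.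
    have h2 : B * (lambda * q) < B * (q * q) by rewrite ltr_pM2l // ltr_pM2r //; lra.
    have h3 : 1 <= q * q by rewrite -[leLHS]mulr1 ler_pM.
    have h4 : B <= B * (q * q) by rewrite -[leLHS]mulr1 ler_pM2l.
    lra.
  rewrite -expRD; apply: (@le_trans _ _ (expR (9 * B) * expR (lambda + lambda))).
    by rewrite ler_pM2r ?expR_gt0 // expR_ge1Dx.
  rewrite -expRD ler_expR.
  have : 0 <= (lambda - 1 / 2) * B by rewrite mulr_ge0 ?subr_ge0 // ltW.
  lra.
move=> m Lm.
have [n nL xn] := exists_small_density b_gt1 l0 (@vlev_eq0 b m) (@vlevB b m) (@vlev_le b m)
    (card_vlev_le b_gt1 (m := m)) Lm L_gt.
apply: le_trans (bound _ _ (leq_trans (ltnW nL) Lm) xn) _.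
by rewrite ler_pM2l // ler_weXn2l ?(ltnW nL) //; apply: le_trans B_ge2; rewrite ler1n.
Qed.

End Bounds.

Theorem theorem1p2 (R : realType) (b : nat) (hb : (2 <= b)%N) :
  exists c C : R, 0 < c /\ 0 < C /\
    forall (lambda : R), 0 < lambda ->
    forall (d : measure_display) (Omega : measurableType d)
      (P : probability Omega R) (N : upair (Gam b) -> {RV P >-> nat}),
      hierarchical_multigraph lambda N ->
      ((expR (c * lambda))%:E < chi N)%E /\
      (chi N < (expR (expR (C * lambda)))%:E)%E.
Proof.
have B0 : (0 : R) < b%:R by rewrite ltr0n ltnW.
exists (64 * b%:R ^+ 2)^-1, (18 * b%:R + 2); split; [|split].
- by rewrite invr_gt0 mulr_gt0 // exprn_gt0.
- by rewrite addr_gt0 // mulr_gt0.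
move=> lambda l0 d Omega P N HN; split.
  have [m m_lt] := chi_box_lower hb l0; rewrite mulrC.
  by apply: lt_le_trans (chi_box_le hb l0 HN m); rewrite lte_fin.
(* [K] bounds all large boxes at once and lies strictly below the double exponential, so strictness
   survives the limit. *)
have [m0 [K [K_lt HK]]] := chi_box_upper hb l0.
by apply: le_lt_trans (chi_le_box hb l0 HN HK) _; rewrite lte_fin.
Qed.
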